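(* Let $X$ be a Polish space with a continuous, strictly positive Borel measure $\mu$. Let $\mathcal{N}$ be the family of Borel subsets of $X$ of $\mu$-measure zero, let $\mathcal{M}$ be the family of Borel meager subsets of $X$, and let $J = \mathcal{M} \cap \mathcal{N}$. Then there exists a $J$-positive Borel set $A \subseteq X$ which does not contain modulo $J$ any $J$-positive closed set.
   Context: A Borel measure $\mu$ on $X$ is continuous if $\mu(\{x\}) = 0$ for every $x \in X$, and strictly positive if $\mu(U) > 0$ for every nonempty open $U \subseteq X$. A Borel set $B \subseteq X$ is called $J$-positive if $B \notin J$. A Borel set $B$ contains a closed set $C$ modulo $J$ if $C \setminus B \in J$.
   Formalization: The measure μ is assumed σ-finite and X nonempty; for arbitrary Borel measures the claim fails (X = R, μ = 0 on countable Borel sets and ∞ on uncountable ones), and it fails for empty X. *)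

(* Defs.v *)
From mathcomp Require Import all_boot all_order all_algebra.
From mathcomp Require Import all_classical all_reals all_analysis.

Set Implicit Arguments.
Unset Strict Implicit.
Unset Printing Implicit Defensive.

Import Order.TTheory GRing.Theory Num.Theory.

Local Open Scope classical_set_scope.
Local Open Scope ring_scope.

(* [R] is the field of real numbers in which distances take their values. *)
Definition is_metric (R : realType) (X : Type) (d : X -> X -> R) : Prop :=
  [/\ forall x y, 0 <= d x y,
      forall x y, d x y = 0 <-> x = y,
      forall x y, d x y = d y x &
      forall x y z, d x z <= d x y + d y z].

Definition induces_topology (R : realType) (X : topologicalType)
    (d : X -> X -> R) : Prop :=
  forall (x : X) (A : set X),
    nbhs x A <-> exists2 e : R, 0 < e & [set y | d x y < e] `<=` A.

Definition complete_metric (R : realType) (X : topologicalType)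
    (d : X -> X -> R) : Prop :=
  forall u : nat -> X,
    (forall e : R, 0 < e ->
       exists N : nat, forall m n : nat,
         (N <= m)%N -> (N <= n)%N -> d (u m) (u n) < e) ->
    exists l : X, u @ \oo --> l.

Definition separable (X : topologicalType) : Prop :=
  exists2 D : set X, countable D & dense D.

Definition polish (R : realType) (X : topologicalType) : Prop :=
  separable X /\
  exists d : X -> X -> R,
    [/\ is_metric d, induces_topology d & complete_metric d].

(* Measurable types are pointed in the library, hence [X] is a pointed
   (equivalently, nonempty) topological space. *)
Notation borel_space X := (g_sigma_algebraType (@open X)).

Definition borel (X : ptopologicalType) (B : set X) : Prop :=
  measurable (B : set (borel_space X)).

Definition continuous_measure (R : realType) (X : ptopologicalType)
    (mu : {measure set (borel_space X) -> \bar R}) : Prop :=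
  forall x : X, mu [set x] = 0%E.

Definition strictly_positive (R : realType) (X : ptopologicalType)
    (mu : {measure set (borel_space X) -> \bar R}) : Prop :=
  forall U : set X, open U -> U !=set0 -> (0%E < mu U)%E.

Definition nowhere_dense (X : topologicalType) (A : set X) : Prop :=
  interior (closure A) = set0.

Definition meager (X : topologicalType) (A : set X) : Prop :=
  exists2 F : nat -> set X,
    (forall n, nowhere_dense (F n)) & A = \bigcup_n F n.

Definition borel_null (R : realType) (X : ptopologicalType)
    (mu : {measure set (borel_space X) -> \bar R}) : set (set X) :=
  [set B | borel B /\ mu B = 0%E].

Definition borel_meager (X : ptopologicalType) : set (set X) :=
  [set B | borel B /\ meager B].

Definition ideal_positive (X : ptopologicalType) (J : set (set X))
    (B : set X) : Prop :=
  borel B /\ ~ J B.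

Definition contains_modulo (X : ptopologicalType) (J : set (set X))
    (B C : set X) : Prop :=
  J (C `\` B).

(* Main.v *)
(* [A] is a comeager null set: it is not in [J] by the Baire category theorem,
   and if [C] is closed with [C `\` A] in [J], then [C] is null, so by strict
   positivity it has empty interior, hence is nowhere dense and lies in [J].
   The set [A] is a countable intersection of open sets of small measure that
   contain a countable dense set; as a sigma-finite measure need not be locally
   finite, smallness of the [n]-th open set is only required on the [n]-th
   member of an exhaustion of [X] by sets of finite measure. *)
Require Import Defs.
From mathcomp Require Import all_boot all_order all_algebra.
From mathcomp Require Import all_classical all_reals all_analysis.

Import Order.TTheory GRing.Theory Num.Theory.

Local Open Scope classical_set_scope.
Local Open Scope ring_scope.

(** * Metric balls and the Baire category theorem *)

Section MetricTopology.
Context {R : realType} {X : topologicalType} {d : X -> X -> R}.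
Hypotheses (md : is_metric d) (td : induces_topology d).

Lemma metric_ball_open (x : X) (e : R) : open [set y | d x y < e].
Proof.
have [_ _ _ dT] := md.
rewrite openE => y /= dxy; apply/td; exists (e - d x y); first by rewrite subr_gt0.
by move=> z /=; rewrite ltrBrDl; apply: le_lt_trans.
Qed.

Lemma bigcap_metric_ball (x : X) :
  \bigcap_n [set y | d x y < n.+1%:R^-1] = [set x].
Proof.
have [d0 dE _ _] := md.
apply/seteqP; split => [y yB|_ -> n _ /=]; last first.
  by rewrite (dE x x).2// invr_gt0.
apply/esym/dE/eqP; rewrite eq_le d0 andbT leNgt; apply/negP => dxy.
have [n /(lt_trans (yB n I))] : exists n, n.+1%:R^-1 < d x y.
  have [n _ nP] := near_infty_natSinv_lt (PosNum dxy).
  by exists n; exact: (nP n (leqnn n)).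
by rewrite ltxx.
Qed.

(** Inside a given open set one builds nested closed balls, the [n.+1]-st lying in [F n], with radii
    tending to 0; by completeness the centers converge, and the limit lies in every ball. *)
Lemma baire_category (F : nat -> set X) :
  complete_metric d -> (forall n, open (F n) /\ dense (F n)) ->
  dense (\bigcap_n F n).
Proof.
have [d0 dE dC dT] := md => cd FP O [x0 Ox0] oO.
have /td [r0 r0_gt0 r0O] : nbhs x0 O by apply: open_nbhs_nbhs.
(* Positivity of the radius is a premise inside the existential, so that [choice] yields a total
   function to iterate. *)
have step (np : nat * (X * R)) : exists q : X * R, 0 < np.2.2 ->
    [/\ 0 < q.2, q.2 <= np.1.+1%:R^-1 & forall z, d q.1 z <= q.2 ->
      d np.2.1 z < np.2.2 /\ F np.1 z].
  case: np => n [x r] /=; have [r_gt0|] := pselect (0 < r); last first.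
    by move=> r_le0; exists (x, r).
  have [oF dF] := FP n.
  have oB := metric_ball_open x r.
  have [|y [xy Fy]] := dF _ _ oB; first by exists x => /=; rewrite (dE x x).2.
  have /td [s s_gt0 sP] : nbhs y ([set y | d x y < r] `&` F n).
    by apply: open_nbhs_nbhs; split => //; exact: openI.
  (* Halving [s] puts the closed ball inside the open [s]-ball; the cap [n.+1%:R^-1] makes the radii
     vanish. *)
  exists (y, Num.min (s / 2) n.+1%:R^-1) => _ /=; split.
  - by rewrite lt_min divr_gt0//= invr_gt0.
  - by rewrite ge_min lexx orbT.
  - move=> z; rewrite le_min => /andP[yz _]; apply: sP => /=.
    by rewrite (le_lt_trans yz)// ltr_pdivrMr// ltr_pMr// ltr1n.
have [f fP] := choice step.
pose w := fix w n := if n is m.+1 then f (m, w m) else (x0, r0).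
have w_gt0 n : 0 < (w n).2.
  by elim: n => [|n IHn] //=; have [] := fP (n, w n) IHn.
have wP n := fP (n, w n) (w_gt0 n).
have nested m n z : (m <= n)%N -> d (w n).1 z <= (w n).2 ->
    d (w m).1 z <= (w m).2.
  move=> /subnK <-; elim: (n - m)%N => [//|k IHk] /=.
  by case: (wP (k + m)%N) => _ _ /[apply] -[/ltW ? _]; exact: IHk.
have center m n : (m <= n)%N -> d (w m).1 (w n).1 <= (w m).2.
  by move=> mn; apply: (nested m n) => //; rewrite (dE _ _).2// ltW.
have [|l ul] := cd (fun n => (w n).1).
  move=> e e_gt0.
  have e2_gt0 : 0 < e / 2 by rewrite divr_gt0.
  have [N _ NP] := near_infty_natSinv_lt (PosNum e2_gt0).
  exists N.+1 => m n Nm Nn.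
  rewrite (le_lt_trans (dT _ (w N.+1).1 _))// [ltRHS]splitr.
  have wN : (w N.+1).2 < e / 2.
    by case: (wP N) => _ wN _; rewrite (le_lt_trans wN)//; exact: (NP N (leqnn N)).
  rewrite (dC (w m).1).
  by apply: ltrD; apply: le_lt_trans wN; exact: center.
have wl n : d (w n).1 l <= (w n).2.
  apply/ler_addgt0Pr => e e_gt0.
  have /ul [N _ NP] : nbhs l [set y | d l y < e] by apply/td; exists e.
  pose m := maxn n N.
  rewrite (le_trans (dT _ (w m).1 _))// lerD//; first by rewrite center// leq_maxl.
  by rewrite dC ltW//; apply: (NP m); rewrite /= leq_maxr.
(* Step [n] places the closed ball of index [n.+1] inside [F n], hence the shift. *)
exists l; split => [|n _]; last by case: (wP n) => _ _ /(_ l (wl n.+1)) [].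
by apply: r0O => /=; case: (wP 0%N) => _ _ /(_ l (wl 1%N)) [].
Qed.

End MetricTopology.

Lemma dense_setC_closure {X : topologicalType} {A : set X} :
  nowhere_dense A -> dense (~` closure A).
Proof.
move=> A0 O [x Ox] oO; apply: contrapT => /nonemptyPn/disjoints_subset.
rewrite setCK => OA; suff : interior (closure A) x by rewrite A0.
by apply: filterS OA _; exact: open_nbhs_nbhs.
Qed.

Lemma comeager_not_meager {R : realType} {X : ptopologicalType}
    {d : X -> X -> R} (U : nat -> set X) :
  is_metric d -> induces_topology d -> complete_metric d ->
  (forall n, open (U n) /\ dense (U n)) -> ~ meager (\bigcap_n U n).
Proof.
move=> md td cd UP [N N0 UN].
have : dense (\bigcap_n (U n `&` ~` closure (N n))).
  apply: (baire_category md td (fun n => U n `&` ~` closure (N n)) cd) => n.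
  have [oU dU] := UP n; split.
    by apply: openI => //; exact/closed_openC/closed_closure.
  by apply: denseI => //; exact: dense_setC_closure.
have T0 : [set: X] !=set0 by exists point.
move=> /(_ setT T0 openT) [x [_ xP]].
have : (\bigcap_n U n) x by move=> n _; case: (xP n I).
by rewrite UN => -[n _ /subset_closure]; case: (xP n I).
Qed.

(** * A null G-delta set containing a given sequence *)

Section NullGdelta.
Context {R : realType} {X : ptopologicalType} {d : X -> X -> R}
  {mu : {measure set (borel_space X) -> \bar R}}.
Hypotheses (md : is_metric d) (td : induces_topology d)
  (mu0 : continuous_measure mu).

Lemma open_measurable_borel (U : set X) :
  open U -> measurable (U : set (borel_space X)).
Proof. exact: sub_sigma_algebra. Qed.

(** The traces on [F] of balls shrinking to [x] decrease to a subset of the null set [[set x]]; as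
    [mu F] is finite, continuity from above applies. *)
Lemma small_open_point (F : set (borel_space X)) (x : X) (e : R) :
  measurable F -> (mu F < +oo)%E -> 0 < e ->
  exists U : set X, [/\ open U, U x & (mu (F `&` U) <= e%:E)%E].
Proof.
move=> mF Foo e_gt0; have [_ dE _ _] := md.
pose B n : set X := [set y | d x y < n.+1%:R^-1].
have oB n : open (B n) := metric_ball_open md td x n.+1%:R^-1.
pose G n : set (borel_space X) := F `&` B n.
have mG n : measurable (G n).
  by apply: measurableI => //; exact: open_measurable_borel.
have mcapG : measurable (\bigcap_n G n) by exact: bigcapT_measurable.
have capG0 : mu (\bigcap_n G n) = 0%E.
  apply/eqP; rewrite eq_le measure_ge0 andbT -(mu0 x).
  apply: le_measure; rewrite ?inE//.
    rewrite -(bigcap_metric_ball md x); apply: bigcapT_measurable => n.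
    exact: (open_measurable_borel _ (oB n)).
  by rewrite -(bigcap_metric_ball md x) => y Gy n _; case: (Gy n I).
have : mu \o G @ \oo --> mu (\bigcap_n G n).
  apply: nonincreasing_cvg_mu => //.
    by apply: le_lt_trans Foo; apply: le_measure; rewrite ?inE//; exact: subIsetl.
  move=> m n mn; apply/subsetPset; apply: setIS => y /= /lt_le_trans; apply.
  by rewrite lef_pV2 ?posrE// ler_nat.
rewrite capG0 => /fine_cvgP[fG /cvgr0Pnorm_lt /(_ e e_gt0) Ge].
have [n [fGn Gne]] := filter_ex (filterI fG Ge).
exists (B n); split => //; first by rewrite /B /= (dE x x).2.
rewrite -[mu _]fineK// lee_fin ltW//; apply: le_lt_trans Gne.
exact: ler_norm.
Qed.

Lemma small_open_sequence (F : set (borel_space X)) (s : nat -> X) (e : R) :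
  measurable F -> (mu F < +oo)%E -> 0 < e ->
  exists U : set X, [/\ open U, range s `<=` U & (mu (F `&` U) <= e%:E)%E].
Proof.
move=> mF Foo e_gt0.
(* The budget [e] is split geometrically among the points, and countable subadditivity recombines
   it. *)
have e_gt0' n : 0 < e / (2 ^ n.+1)%:R by rewrite divr_gt0// ltr0n expn_gt0.
have [V VP] := choice (fun n => small_open_point F (s n) _ mF Foo (e_gt0' n)).
have oV n : open (V n) by case: (VP n).
exists (\bigcup_n V n); split.
- exact: bigcup_open.
- by move=> _ [n _ <-]; exists n => //; case: (VP n).
- have mV n : measurable (V n : set (borel_space X)).
    exact: open_measurable_borel.
  apply: le_trans (epsilon_trick0 xpredT (ltW e_gt0)).
  apply: (@le_trans _ _ (\sum_(n <oo) mu (F `&` V n))%E).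
    apply: measure_sigma_subadditive.
    + by move=> n; exact: measurableI.
    + by apply: measurableI => //; exact: bigcupT_measurable.
    + by rewrite setI_bigcupr.
  by apply: lee_nneseries => [n _ _|n _]; [exact: measure_ge0|case: (VP n)].
Qed.

Lemma null_Gdelta_sequence (s : nat -> X) :
  sigma_finite [set: borel_space X] mu ->
  exists U : nat -> set X,
    [/\ forall n, open (U n), forall n, range s `<=` U n &
        mu (\bigcap_n U n) = 0%E].
Proof.
move=> /sigma_finiteP[F [FT ndF mF]].
have i_gt0 n : 0 < n.+1%:R^-1 :> R by rewrite invr_gt0.
have [U UP] := choice (fun n =>
  small_open_sequence (F n) s _ (mF n).1 (mF n).2 (i_gt0 n)).
have oU n : open (U n) by case: (UP n).
have mU n : measurable (U n : set (borel_space X)) by exact: open_measurable_borel.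
exists U; split => // [n|]; first by case: (UP n).
have mA : measurable (\bigcap_n U n : set (borel_space X)).
  exact: bigcapT_measurable.
have FA0 n : mu (F n `&` \bigcap_n U n) = 0%E.
  apply/eqP; rewrite eq_le measure_ge0 andbT; apply/lee_addgt0Pr => e e_gt0.
  rewrite add0e; have [N _ NP] := near_infty_natSinv_lt (PosNum e_gt0).
  (* [m >= n] gives [F n] inside [F m], where [U m] is small; [m >= N] makes the bound [m.+1%:R^-1]
     less than [e]. *)
  pose m := maxn n N.
  apply: (@le_trans _ _ m.+1%:R^-1%:E); last first.
    by rewrite lee_fin ltW//; apply: (NP m); rewrite /= leq_maxr.
  have [_ _] := UP m; apply: le_trans.
  apply: le_measure; rewrite ?inE.
  - by apply: measurableI => //; exact: (mF n).1.
  - by apply: measurableI => //; exact: (mF m).1.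
  - apply: setISS; first by apply/subsetPset/ndF; exact: leq_maxl.
    exact: bigcap_inf.
rewrite -[\bigcap_n U n]setTI FT setI_bigcupl.
apply/eqP; rewrite eq_le measure_ge0 andbT.
apply: (@le_trans _ _ (\sum_(n <oo) mu (F n `&` \bigcap_n U n))%E).
  apply: measure_sigma_subadditive => //.
    by move=> n; apply: measurableI => //; exact: (mF n).1.
  by apply: bigcupT_measurable => n; apply: measurableI => //; exact: (mF n).1.
by rewrite eseries0.
Qed.

End NullGdelta.

(** * Closed null sets and the conclusion *)

Lemma closed_null_in_ideal {R : realType} {X : ptopologicalType}
    {mu : {measure set (borel_space X) -> \bar R}} {C : set X} :
  strictly_positive mu -> closed C -> borel C -> mu C = 0%E ->
  (@borel_meager X `&` borel_null mu) C.
Proof.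
move=> pmu cC bC C0; do 2!split => //.
exists (fun=> C); last by rewrite bigcup_const.
move=> _; rewrite /nowhere_dense -(closure_id C).1//.
apply: contrapT => /eqP/set0P CN0.
have := pmu _ (open_interior C) CN0; rewrite ltNge -C0 => /negP; apply.
apply: le_measure; rewrite ?inE//; last exact: interior_subset.
exact: (open_measurable_borel _ (open_interior C)).
Qed.

Theorem mainTheorem1 (R : realType) (X : ptopologicalType)
    (mu : {measure set (borel_space X) -> \bar R}) :
  polish R X ->
  sigma_finite [set: borel_space X] mu ->
  continuous_measure mu ->
  strictly_positive mu ->
  let J : set (set X) := @borel_meager X `&` borel_null mu in
  exists A : set X,
    ideal_positive J A /\
    ~ (exists C : set X,
         [/\ closed C, ideal_positive J C & contains_modulo J A C]).
Proof.
move=> [[D cD dD] [d [md td cd]]] sf cmu pmu J.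
have [s Ds] : exists s : nat -> X, D `<=` range s.
  by have /pcard_surjP[s ?] := cD; exists s.
have [U [oU sU A0]] := null_Gdelta_sequence md td cmu s sf.
have dU n : dense (U n).
  move=> O O0 oO; have [x [Ox /Ds /sU Ux]] := dD O O0 oO.
  by exists x; split => //; exact: Ux.
have bA : borel (\bigcap_n U n).
  by apply: bigcapT_measurable => n; exact: open_measurable_borel.
exists (\bigcap_n U n); split.
  by split => // -[[_ +] _]; apply: (comeager_not_meager U md td cd).
move=> [C [cC [bC JC] [_ [bCA CA0]]]]; apply: JC.
apply: closed_null_in_ideal => //.
(* [C] splits into its part outside the G-delta, null by containment modulo [J], and its part
   inside, null because the G-delta is. *)
rewrite (measureDI mu bC bA) [X in (X + _)%E]CA0 add0e.
by apply: (subset_measure0 _ _ _ A0) => //; exact: measurableI.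
Qed.
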